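(* Assume there exists $(\gamma_0^*,\gamma^* )\in\Gamma$ with $A(\gamma_0^*,\gamma^* )\succ 0$, and assume that $\Gamma^\circ$ is facially exposed. Then $\operatorname{conv}(\mathcal S)=\mathcal S_{\mathrm{SDP}}$ if and only if for every $(x,t)\in\mathcal S_{\mathrm{SDP}}\setminus\mathcal S$ the set $\mathcal R'(x,t)$ is nontrivial (i.e., $\mathcal R'(x,t)\ne\{0\}$).
   Context: Let $n,m$ be positive integers. Let $\mathbb S^n$ be the real symmetric $n\times n$ matrices with trace inner product. For $i\in\{0,1,\dots,m\}$ let $q_i:\mathbb R^n\to\mathbb R$, $q_i(x)=x^\top A_i x+2b_i^\top x+c_i$ with $A_i\in\mathbb S^n$, $b_i\in\mathbb R^n$, $c_i\in\mathbb R$ (possibly nonconvex); $q_0$ is the objective and $q_1,\dots,q_m$ are the constraints. Let $q(x)=(q_0(x),\dots,q_m(x))\in\mathbb R^{1+m}$ and let $e_0\in\mathbb R^{1+m}$ be the unit vector of the coordinate indexed $0$. For $(\gamma_0,\gamma)\in\mathbb R^{1+m}$ let $A(\gamma_0,\gamma)=\sum_{i=0}^m\gamma_iA_i$. Define $$\Gamma=\{(\gamma_0,\gamma)\in\mathbb R_+\times\mathbb R_+^m: A(\gamma_0,\gamma)\succeq 0\}.$$ Epigraph of the QCQP: $\mathcal S=\{(x,t)\in\mathbb R^n\times\mathbb R: q_0(x)\le 2t,\ q_i(x)\le 0\ \forall i\in\{1,\dots,m\}\}$. Projected SDP relaxation: $\mathcal S_{\mathrm{SDP}}$ is the set of $(x,t)\in\mathbb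 R^n\times\mathbb R$ for which there is $X\in\mathbb S^n$ with $X\succeq xx^\top$, $\langle A_0,X\rangle+2b_0^\top x+c_0\le 2t$, and $\langle A_i,X\rangle+2b_i^\top x+c_i\le 0$ for all $i\in\{1,\dots,m\}$. Polar cone: $\Gamma^\circ=\{y\in\mathbb R^{1+m}:\langle y,g\rangle\le 0\ \forall g\in\Gamma\}$. Under the first assumption in the claim, $(x,t)\in\mathcal S_{\mathrm{SDP}}$ if and only if $q(x)-2te_0\in\Gamma^\circ$. Faces of cones are nonempty by convention. A face $\mathcal G$ of $\Gamma^\circ$ is exposed if there is $(\gamma_0,\gamma)\in\Gamma$ with $\mathcal G=\Gamma^\circ\cap(\gamma_0,\gamma)^\perp$; $\Gamma^\circ$ is facially exposed if every face of $\Gamma^\circ$ is exposed. For $(x,t)\in\mathcal S_{\mathrm{SDP}}$, let $\mathcal G(x,t)$ be the minimal face of $\Gamma^\circ$ containing $q(x)-2te_0$, and define $$\mathcal R'(x,t)=\{(x',t')\in\mathbb R^{n+1}: q(x+\alpha x')-2(t+\alpha t')e_0\in\operatorname{span}(\mathcal G(x,t))\ \ \forall\alpha\in\mathbb R\}.$$ *)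

(* Defs.v *)
From mathcomp Require Import all_boot all_order all_algebra.
From mathcomp Require Import boolp classical_sets reals convex.

Set Implicit Arguments.
Unset Strict Implicit.
Unset Printing Implicit Defensive.

Import Order.TTheory GRing.Theory Num.Theory.

Local Open Scope classical_set_scope.
Local Open Scope ring_scope.

Section MatricesAndConvexity.
Variable R : realType.

Definition dot k (u v : 'cV[R]_k) : R := (u^T *m v) 0 0.

Definition psd k (M : 'M[R]_k) : Prop :=
  M \is symmetricmx /\ forall v : 'cV[R]_k, 0 <= (v^T *m M *m v) 0 0.

Definition posdef k (M : 'M[R]_k) : Prop :=
  M \is symmetricmx /\
  forall v : 'cV[R]_k, v != 0 -> 0 < (v^T *m M *m v) 0 0.

Definition conv_hull (E : lmodType R) (D : set E) : set E :=
  smallest (@convex_set R E) D.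

(* Linear span of an arbitrary, possibly infinite, set of vectors. *)
Definition lin_span k (G : set 'cV[R]_k) : set 'cV[R]_k :=
  [set y | exists2 s : seq 'cV[R]_k, [set` s] `<=` G & y \in <<s>>%VS].

Definition polar k (G : set 'cV[R]_k) : set 'cV[R]_k :=
  [set y | forall g, G g -> dot y g <= 0].

(* A nonempty face, in the sense of convex sets, of a convex cone is itself a
   convex cone. *)
Definition is_face k (K F : set 'cV[R]_k) : Prop :=
  [/\ F !=set0, F `<=` K, @convex_set R 'cV[R]_k F &
      forall (y z : 'cV[R]_k) (l : R), K y -> K z -> 0 < l < 1 ->
        F (l *: y + (1 - l) *: z) -> F y /\ F z].

Definition min_face k (K : set 'cV[R]_k) (y : 'cV[R]_k) : set 'cV[R]_k :=
  smallest (is_face K) [set y].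

(* The two predicates below concern faces of polar G; the exposing vectors
   range over G. *)
Definition polar_exposed k (G F : set 'cV[R]_k) : Prop :=
  exists2 g, G g & F = polar G `&` [set y | dot y g = 0].

Definition polar_facially_exposed k (G : set 'cV[R]_k) : Prop :=
  forall F, is_face (polar G) F -> polar_exposed G F.

End MatricesAndConvexity.

(* Index ord0 is the objective; the indices lift ord0 i are the constraints. *)
Section QCQP.
Variables (R : realType) (n m : nat).
Variables (A : 'I_m.+1 -> 'M[R]_n) (b : 'I_m.+1 -> 'cV[R]_n).
Variable c : 'I_m.+1 -> R.

Definition quad (i : 'I_m.+1) (x : 'cV[R]_n) : R :=
  (x^T *m A i *m x) 0 0 + 2 * dot (b i) x + c i.

Definition lifted_quad (i : 'I_m.+1) (X : 'M[R]_n) (x : 'cV[R]_n) : R :=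
  \tr (A i *m X) + 2 * dot (b i) x + c i.

Definition aggregate (g : 'cV[R]_m.+1) : 'M[R]_n :=
  \sum_(i < m.+1) g i 0 *: A i.

Definition Gamma : set 'cV[R]_m.+1 :=
  [set g : 'cV[R]_m.+1 | (forall i, 0 <= g i 0) /\ psd (aggregate g)].

Definition epigraph : set ('cV[R]_n * R^o) :=
  [set p | quad ord0 p.1 <= 2 * p.2 /\
           forall i : 'I_m, quad (lift ord0 i) p.1 <= 0].

Definition sdp_relaxation : set ('cV[R]_n * R^o) :=
  [set p | exists X : 'M[R]_n,
     [/\ X \is symmetricmx, psd (X - p.1 *m p.1^T),
         lifted_quad ord0 X p.1 <= 2 * p.2 &
         forall i : 'I_m, lifted_quad (lift ord0 i) X p.1 <= 0]].

(* q(x) - 2 t e_0 *)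
Definition shifted_quad (p : 'cV[R]_n * R^o) : 'cV[R]_m.+1 :=
  (\col_i quad i p.1) - (2 * (p.2 : R)) *: delta_mx ord0 0.

Definition rounding_dirs (p : 'cV[R]_n * R^o) : set ('cV[R]_n * R^o) :=
  [set d | forall a : R,
     lin_span (min_face (polar Gamma) (shifted_quad p))
       (shifted_quad (p + a *: d))].

End QCQP.

(* Main.v *)
Require Import Defs.
From mathcomp Require Import all_boot all_order all_algebra.
From mathcomp Require Import ring lra.
From mathcomp Require Import interval_inference.
From mathcomp Require Import boolp classical_sets reals convex.
From mathcomp Require Import topology normedtype derive.

(** Write [K] for the polar cone of [Gamma] and [y(p)] for the vector
    [q(x) - 2 t e_0] of a point [p = (x, t)].  Conic duality
    ([sdp_relaxation_polar]) turns the relaxation into the set of the [p] with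
    [y(p)] in [K].  Along a line, [y(p + a d) = y(p) + a u + a^2 w], and for [g]
    in [Gamma] the function [<y(p + a d), g>] of [a] is convex, because its
    leading coefficient is the value at [d] of the positive semidefinite form
    [A(g)].

    The span of the minimal face of [y] in a convex cone is the set of the [z]
    for which [l y + z] and [l y - z] are both in the cone for some [l >= 0]
    ([lin_span_min_face]).  Hence [d] is a rounding direction at [p] exactly
    when [u] and [w] lie in that set ([rounding_dirsP]), and then [y(p + a d)]
    stays in [K] for all small [a].

    Suppose that each point of the relaxation outside the epigraph has a nonzero
    rounding direction [d].  Some [g] in [Gamma] has [A(g)] positive definite and
    a positive objective coordinate, so a ray from [p] in direction [d] leaves
    the relaxation unless [d] is vertical and points upwards.  The last point
    inside the relaxation has a minimal face whose span is strictly smaller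
    ([polar_curve_exit]).  So [p] lies between two such points, or above one of
    them, and induction on the dimension of the span puts [p] in the convex hull
    of the epigraph, which is closed under upward translation
    ([rounding_conv_hull]).

    Suppose now that the convex hull of the epigraph is the relaxation, and take
    [p] in the relaxation but not in the epigraph.  Since [p] is not an extreme
    point of the hull, it is interior to a segment of the relaxation with a
    nonzero direction [d].  If [g] exposes the minimal face of [y(p)], then
    [<y(p + a d), g>] is convex in [a], nonpositive at the ends of the segment
    and zero at [p], so it vanishes identically; the end points are then mapped
    into the minimal face, and [d] is a rounding direction
    ([conv_hull_rounding]).

    Conic duality is proved by minimizing, over the positive semidefinite
    matrices, the squared violation of the constraints ([psd_of_polar_Gamma]);
    the minimum is attained because a positive definite [A(g)] bounds the trace
    on the sublevel sets. *)

Set Implicit Arguments.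
Unset Strict Implicit.
Unset Printing Implicit Defensive.

Import Order.TTheory GRing.Theory Num.Theory.
Import numFieldNormedType.Exports.

Local Open Scope classical_set_scope.
Local Open Scope ring_scope.

(** * Quadratic forms and positive semidefinite matrices *)

Section QuadraticForms.
Variables (R : realType) (k : nat).
Implicit Types (M P Q : 'M[R]_k) (u v w : 'cV[R]_k) (a : R).

(** The bilinear form with Gram matrix [M]. *)
Definition form M u v : R := (u^T *m M *m v) 0 0.

Lemma formDl M u v w : form M (u + v) w = form M u w + form M v w.
Proof. by rewrite /form linearD /= !mulmxDl mxE. Qed.

Lemma formDr M u v w : form M u (v + w) = form M u v + form M u w.
Proof. by rewrite /form mulmxDr mxE. Qed.

Lemma formZl M a u v : form M (a *: u) v = a * form M u v.
Proof. by rewrite /form linearZ /= -!scalemxAl mxE. Qed.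

Lemma formZr M a u v : form M u (a *: v) = a * form M u v.
Proof. by rewrite /form -scalemxAr mxE. Qed.

Lemma formB M P u v : form (M - P) u v = form M u v - form P u v.
Proof. by rewrite /form mulmxBr mulmxBl mxE [X in _ + X]mxE. Qed.

Lemma formD M P u v : form (M + P) u v = form M u v + form P u v.
Proof. by rewrite /form mulmxDr mulmxDl mxE. Qed.

Lemma formZ M a u v : form (a *: M) u v = a * form M u v.
Proof. by rewrite /form -scalemxAr -scalemxAl mxE. Qed.

Lemma symmetricmxP M : reflect (M^T = M) (M \is symmetricmx).
Proof.
rewrite qualifE /= expr0 scale1r map_mx_id //.
by apply: (iffP eqP) => /esym.
Qed.

Lemma formC M u v : M \is symmetricmx -> form M u v = form M v u.
Proof.
move=> /symmetricmxP MT; rewrite /form -[LHS]trace_mx11 -mxtrace_tr trace_mx11.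
by rewrite !trmx_mul trmxK MT mulmxA.
Qed.

Lemma form1 u v : form 1%:M u v = dot u v.
Proof. by rewrite /form mulmx1. Qed.

Lemma form_trace M u : \tr (M *m (u *m u^T)) = form M u u.
Proof. by rewrite mulmxA mxtrace_mulC mulmxA trace_mx11. Qed.

Lemma form_delta M i j : form M (delta_mx i 0) (delta_mx j 0) = M i j.
Proof. by rewrite /form trmx_delta -rowE -colE !mxE. Qed.

Lemma form_expand M u v a : M \is symmetricmx ->
  form M (u + a *: v) (u + a *: v) =
    form M u u + a * (2 * form M u v) + a ^+ 2 * form M v v.
Proof.
move=> Ms; rewrite formDl !formDr !formZl !formZr (formC v u Ms); ring.
Qed.

Lemma symmetricmxD M P :
  M \is symmetricmx -> P \is symmetricmx -> M + P \is symmetricmx.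
Proof.
move=> /symmetricmxP MT /symmetricmxP PT; apply/symmetricmxP.
by rewrite linearD /= MT PT.
Qed.

Lemma symmetricmxZ a M : M \is symmetricmx -> a *: M \is symmetricmx.
Proof. by move=> /symmetricmxP MT; apply/symmetricmxP; rewrite linearZ /= MT. Qed.

Lemma symmetricmxB M P :
  M \is symmetricmx -> P \is symmetricmx -> M - P \is symmetricmx.
Proof.
by move=> Ms Ps; rewrite -scaleN1r; apply: symmetricmxD => //; apply: symmetricmxZ.
Qed.

Lemma symmetricmx_outer u : u *m u^T \is symmetricmx.
Proof. by apply/symmetricmxP; rewrite trmx_mul trmxK. Qed.

Lemma symmetricmx1 : (1%:M : 'M[R]_k) \is symmetricmx.
Proof. by apply/symmetricmxP; rewrite trmx1. Qed.

Lemma form_outer w u v : form (w *m w^T) u v = dot u w * dot w v.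
Proof.
rewrite /form mulmxA -(mulmxA (u^T *m w)) [_ *m (w^T *m v)]mx11_scalar.
by rewrite !mxE big_ord1 eqxx mulr1n.
Qed.

Lemma dotC u v : dot u v = dot v u.
Proof. by rewrite -!form1 formC // symmetricmx1. Qed.

Lemma dotDl u v w : dot (u + v) w = dot u w + dot v w.
Proof. by rewrite -!form1 formDl. Qed.

Lemma dotZl a u v : dot (a *: u) v = a * dot u v.
Proof. by rewrite -!form1 formZl. Qed.

Lemma dotDr u v w : dot u (v + w) = dot u v + dot u w.
Proof. by rewrite -!form1 formDr. Qed.

Lemma dotZr a u v : dot u (a *: v) = a * dot u v.
Proof. by rewrite -!form1 formZr. Qed.

Lemma dotE u v : dot u v = \sum_i u i 0 * v i 0.
Proof. by rewrite /dot mxE; apply: eq_bigr => i _; rewrite mxE. Qed.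

Lemma dot_ge0 u : 0 <= dot u u.
Proof. by rewrite dotE sumr_ge0 // => i _; rewrite -expr2 sqr_ge0. Qed.

Lemma dot_gt0 u : u != 0 -> 0 < dot u u.
Proof.
move=> u0; rewrite lt_neqAle dot_ge0 andbT eq_sym; apply: contraNneq u0.
rewrite dotE => /eqP; rewrite psumr_eq0; last by move=> i _; rewrite -expr2 sqr_ge0.
move=> /allP u0; apply/eqP/colP => i; rewrite mxE; apply/eqP.
by have := u0 i; rewrite mem_index_enum mulf_eq0 orbb => /(_ isT).
Qed.

Lemma psd_outer u : psd (u *m u^T).
Proof.
split; first exact: symmetricmx_outer.
by move=> v; rewrite -/(form _ _ _) form_outer [dot u v]dotC -expr2 sqr_ge0.
Qed.

Lemma psdD M P : psd M -> psd P -> psd (M + P).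
Proof.
move=> [Ms M0] [Ps P0]; split=> [|v]; first exact: symmetricmxD.
by rewrite -/(form _ _ _) formD addr_ge0 ?M0 ?P0.
Qed.

Lemma psdZ a M : 0 <= a -> psd M -> psd (a *: M).
Proof.
move=> a0 [Ms M0]; split=> [|v]; first exact: symmetricmxZ.
by rewrite -/(form _ _ _) formZ mulr_ge0 ?M0.
Qed.

Lemma psd0 : psd (0 : 'M[R]_k).
Proof.
by split=> [|v]; [apply/symmetricmxP; rewrite trmx0 | rewrite mulmx0 mul0mx mxE].
Qed.

(** A real quadratic polynomial that is nowhere negative has nonpositive
    discriminant. *)
Lemma discriminant_le (x y z : R) :
  (forall a, 0 <= x + a * (2 * y) + a ^+ 2 * z) -> y ^+ 2 <= x * z.
Proof.
move=> h; have [z0|z0] := eqVneq z 0.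
  have [->|y0] := eqVneq y 0; first by rewrite z0 mulr0 expr0n.
  have := h (- (x + 1) / (2 * y)).
  have -> : x + - (x + 1) / (2 * y) * (2 * y) + (- (x + 1) / (2 * y)) ^+ 2 * z = -1.
    by rewrite z0; field.
  by rewrite oppr_ge0 ler10.
have x0 : 0 <= x by have := h 0; rewrite mul0r expr0n mul0r !addr0.
have zgt0 : 0 < z.
  rewrite lt_neqAle eq_sym z0 /=; rewrite leNgt; apply/negP => zlt0.
  (* for [z < 0] the value at a large enough [t] is negative *)
  have [t [t1 tb]] : exists t, 1 <= t /\ x + 2 * `|y| < t * - z.
    exists (1 + (x + 2 * `|y|) / - z).
    have -> : (1 + (x + 2 * `|y|) / - z) * - z = - z + (x + 2 * `|y|) by field.
    split; last by rewrite ltrDr oppr_gt0.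
    by rewrite lerDl divr_ge0 ?addr_ge0 ?mulr_ge0 // oppr_ge0 ltW.
  have := h t; have := ler_norm y; have := normr_ge0 y; nra.
have := h (- y / z).
have -> : x + - y / z * (2 * y) + (- y / z) ^+ 2 * z = (x * z - y ^+ 2) / z by field.
by rewrite pmulr_lge0 ?invr_gt0 // subr_ge0.
Qed.

Lemma psd_CauchySchwarz M u v : psd M ->
  form M u v ^+ 2 <= form M u u * form M v v.
Proof.
move=> [Ms M0]; apply: discriminant_le => a.
by rewrite -form_expand //; apply: M0.
Qed.

Lemma psd_kernel M u : psd M -> form M u u = 0 -> forall v, form M v u = 0.
Proof.
move=> Mp u0 v; have := psd_CauchySchwarz v u Mp.
by rewrite u0 mulr0 => h; apply/eqP; rewrite -sqrf_eq0 eq_le h sqr_ge0.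
Qed.

(** The positive semidefinite cone is contained in its dual.  Peeling off the
    rank-one matrix [(Q e) (Q e)^T / e^T Q e] from [Q] keeps it positive
    semidefinite, by Cauchy-Schwarz, and lowers its rank. *)
Lemma psd_trace_ge0 P Q : psd P -> psd Q -> 0 <= \tr (P *m Q).
Proof.
move=> Pp; have [r] := ubnP (\rank Q); elim: r Q => // r IH Q rQ Qp.
have [Qs Q0] := Qp; have /symmetricmxP QT := Qs.
have [[e e0]|noe] := pselect (exists e, form Q e e != 0); last first.
  suff -> : Q = 0 by rewrite mulmx0 mxtrace0.
  apply/matrixP => i j; rewrite -form_delta [RHS]mxE; apply: psd_kernel => //.
  by apply: contrapT => h; apply: noe; exists (delta_mx j 0); apply/eqP.
pose q := form Q e e; have q0 : 0 < q by rewrite lt_neqAle eq_sym e0 Q0.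
pose u := Q *m e; pose Q' := Q - q^-1 *: (u *m u^T).
have dotu v : dot v u = form Q v e by rewrite /dot /form mulmxA.
have Q'p : psd Q'.
  split; first by apply: symmetricmxB => //; apply/symmetricmxZ/symmetricmx_outer.
  move=> v; rewrite -/(form _ _ _) formB formZ form_outer [dot u v]dotC dotu.
  by rewrite subr_ge0 mulrC ler_pdivrMr // -expr2 psd_CauchySchwarz.
have Q'E : Q' = (1%:M - q^-1 *: (u *m e^T)) *m Q.
  rewrite mulmxBl mul1mx -scalemxAl -mulmxA; congr (_ - _ *: (_ *m _)).
  by rewrite trmx_mul QT.
have Q'e : Q' *m e = 0.
  rewrite mulmxBl -/u -scalemxAl -mulmxA [u^T *m e]mx11_scalar.
  have -> : (u^T *m e) 0 0 = q by rewrite -/(dot u e) dotC dotu.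
  by rewrite mul_mx_scalar scalerA mulVf ?gt_eqF // scale1r subrr.
have rQ' : (\rank Q' < \rank Q)%N.
  apply: rank_ltmx; rewrite /ltmx Q'E submxMl /= -Q'E; apply/negP => /submxP[D QD].
  by move: e0; rewrite /form -mulmxA QD -mulmxA Q'e !mulmx0 mxE eqxx.
have -> : Q = Q' + q^-1 *: (u *m u^T) by rewrite subrK.
rewrite mulmxDr linearD /= -scalemxAr linearZ /= form_trace addr_ge0 //.
  by apply: IH Q'p; apply: leq_trans rQ' _.
by rewrite mulr_ge0 ?invr_ge0 ?(ltW q0) //; apply Pp.2.
Qed.

Lemma formE M u v : form M u v = \sum_i \sum_j u i 0 * M i j * v j 0.
Proof.
rewrite /form -mulmxA mxE; apply: eq_bigr => i _.
by rewrite !mxE mulr_sumr; apply: eq_bigr => j _; rewrite mulrA.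
Qed.

Lemma sqr_le_dot u i : u i 0 ^+ 2 <= dot u u.
Proof.
rewrite dotE (bigD1 i) //= -expr2 lerDl sumr_ge0 // => j _.
by rewrite -expr2 sqr_ge0.
Qed.

Lemma form_bounded M :
  exists2 B : R, 0 < B & forall u, `|form M u u| <= B * dot u u.
Proof.
exists (1 + \sum_i \sum_j `|M i j|) => [|u].
  by rewrite ltr_pwDl // sumr_ge0 // => i _; rewrite sumr_ge0.
apply: (@le_trans _ _ ((\sum_i \sum_j `|M i j|) * dot u u)); last first.
  by rewrite ler_wpM2r ?dot_ge0 // lerDr.
rewrite formE mulr_suml; apply: le_trans (ler_norm_sum _ _ _) _.
apply: ler_sum => i _; rewrite mulr_suml; apply: le_trans (ler_norm_sum _ _ _) _.
apply: ler_sum => j _; rewrite mulrAC !normrM [leRHS]mulrC ler_wpM2r //.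
have := sqr_le_dot u i; have := sqr_le_dot u j.
rewrite -(real_normK (num_real (u i 0))) -(real_normK (num_real (u j 0))).
by have := normr_ge0 (u i 0); have := normr_ge0 (u j 0); nra.
Qed.

(** A positive definite matrix dominates a positive multiple of the identity.
    Cauchy-Schwarz for [P] and the vectors [u], [P^-1 u] gives
    [(u^T u)^2 <= (u^T P u) (u^T P^-1 u)], and the last factor is at most a
    multiple of [u^T u]. *)
Lemma posdef_lower_bound P : posdef P ->
  exists2 mu : R, 0 < mu & psd (P - mu *: 1%:M).
Proof.
move=> [Ps Ppos].
have Pp : psd P.
  split=> // v; have [->|v0] := eqVneq v 0; first by rewrite mulmx0 mxE.
  exact/ltW/Ppos.
have Pu : P \in unitmx.
  rewrite -row_free_unit -kermx_eq0; apply/eqP/row_matrixP => i; rewrite row0.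
  set v := row i _.
  have vP : v *m P = 0 by rewrite -row_mul mulmx_ker row0.
  apply: contra_eq (erefl (form P v^T v^T)) => v0.
  rewrite {1}/form trmxK vP mul0mx mxE eq_sym gt_eqF //; apply: Ppos.
  by rewrite trmx_eq0.
have [B B0 hB] := form_bounded (invmx P).
exists B^-1; first by rewrite invr_gt0.
split; first by apply: symmetricmxB => //; apply: symmetricmxZ; apply: symmetricmx1.
move=> u; rewrite -/(form _ _ _) formB formZ form1 subr_ge0.
have [->|u0] := eqVneq u 0; first by rewrite -form1 /form !mulmx0 mxE mulr0.
have d0 := dot_gt0 u0.
have := psd_CauchySchwarz u (invmx P *m u) Pp.
have -> : form P u (invmx P *m u) = dot u u by rewrite /form -!mulmxA mulKVmx.
have -> : form P (invmx P *m u) (invmx P *m u) = form (invmx P) u u.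
  by rewrite /form -mulmxA mulKVmx // -/(dot _ _) dotC /dot mulmxA.
move=> cs; rewrite mulrC ler_pdivrMr // -(ler_pM2r d0) -expr2 (le_trans cs) //.
rewrite -mulrA ler_wpM2l ?Pp.2 //; apply: le_trans (hB u); exact: ler_norm.
Qed.

End QuadraticForms.

(** * Convex hulls *)

Section ConvexSets.
Variables (R : realType) (E : lmodType R).
Implicit Types (D : set E) (x y : E) (l : R).

Lemma convex_setP D :
  @convex_set R E D <->
  forall x y l, 0 < l < 1 -> D x -> D y -> D (l *: x + (1 - l) *: y).
Proof.
split=> [cD x y l /andP[l0 l1] Dx Dy|cD].
  by have := cD x y (Itv01 (ltW l0) (ltW l1)); rewrite !in_setE => /(_ Dx Dy).
apply/convex_setW => x y; rewrite !in_setE => Dx Dy l l0 l1.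
by rewrite in_setE; apply: cD; rewrite ?l0.
Qed.

Lemma conv_hull_sub D D' :
  D `<=` D' -> @convex_set R E D' -> conv_hull D `<=` D'.
Proof. by move=> sD cD; apply: smallest_sub. Qed.

Lemma sub_conv_hull D : D `<=` conv_hull D.
Proof. exact: sub_gen_smallest. Qed.

Lemma convex_conv_hull D : @convex_set R E (conv_hull D).
Proof.
apply/convex_setP => x y l l01 Dx Dy D' [cD' DD'].
by move/convex_setP: (cD'); apply=> //; [apply: Dx|apply: Dy].
Qed.

(** A point of the convex hull outside the generating set is not an extreme
    point of the hull, as deleting an extreme point leaves a convex set. *)
Lemma conv_hull_not_extreme D x : conv_hull D x -> ~ D x ->
  exists y z l, [/\ conv_hull D y, conv_hull D z, y != x, 0 < l < 1
    & x = l *: y + (1 - l) *: z].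
Proof.
move=> Dx nDx; apply: contrapT => h.
suff /(_ x Dx) [] : conv_hull D `<=` conv_hull D `&` [set y | y != x].
  by rewrite /= eqxx.
apply: conv_hull_sub => [y Dy|].
  by split; [exact: sub_conv_hull|apply: contra_notN nDx => /eqP <-].
apply/convex_setP => y z l l01 [Dy yx] [Dz zx]; split.
  by move/convex_setP: (@convex_conv_hull D); apply.
by apply/negP => /eqP xE; apply: h; exists y, z, l.
Qed.

Lemma conv_hull_translate D v :
  (forall x, D x -> D (x + v)) -> forall x, conv_hull D x -> conv_hull D (x + v).
Proof.
move=> Dv; apply: (@conv_hull_sub D [set x | conv_hull D (x + v)]).
  by move=> x /Dv; apply: sub_conv_hull.
apply/convex_setP => x y l l01 Dx Dy /=.
have -> : l *: x + (1 - l) *: y + v = l *: (x + v) + (1 - l) *: (y + v).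
  by rewrite !scalerDr addrACA -scalerDl subrKC scale1r.
by move/convex_setP: (@convex_conv_hull D); apply.
Qed.

End ConvexSets.

(** * Faces of convex cones *)

Section Subspaces.
Variables (R : realType) (k : nat).
Implicit Types (S : set 'cV[R]_k) (U : {vspace 'cV[R]_k}).

(** A set of vectors closed under linear combinations is a subspace: take a
    subspace of largest dimension among those contained in the set. *)
Lemma linear_closed_vspace S :
  S 0 -> (forall a u v, S u -> S v -> S (a *: u + v)) ->
  exists U, forall v, v \in U <-> S v.
Proof.
move=> S0 SL; pose P d := `[< exists2 U, \dim U = d & forall v, v \in U -> S v >].
have exP : exists d, P d.
  exists 0%N; apply/asboolP; exists 0%VS; first by rewrite dimv0.
  by move=> v; rewrite memv0 => /eqP ->.
have ubP d : P d -> (d <= k)%N.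
  move=> /asboolP[U <- _]; apply: leq_trans (dimvS (subvf U)) _.
  by rewrite dimvf /dim /= muln1.
case: (ex_maxnP exP ubP) => d /asboolP[U dU US] dmax; exists U => v.
split=> [/US //|Sv]; have [//|vU] := boolP (v \in U).
have : P (\dim (U + <[v]>)%VS).
  apply/asboolP; exists (U + <[v]>)%VS => // x /memv_addP[u uU [_ /vlineP[a ->] ->]].
  by rewrite addrC; apply: SL => //; apply: US.
move=> /dmax; rewrite -dU => dle.
have /eqP UE : U == (U + <[v]>)%VS by rewrite eqEdim addvSl.
by move: vU; rewrite UE (subvP (addvSr _ _)) // memv_line.
Qed.

End Subspaces.

Section Faces.
Variables (R : realType) (k : nat).
Implicit Types (K G : set 'cV[R]_k) (y z u v w : 'cV[R]_k) (a l : R).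

(** A convex cone, required to contain the origin. *)
Definition convex_cone K : Prop :=
  [/\ K 0, forall y z, K y -> K z -> K (y + z)
    & forall a y, 0 <= a -> K y -> K (a *: y)].

Lemma convex_cone_polar G : convex_cone (polar G).
Proof.
split=> [g _|y z Ky Kz g Gg|a y a0 Ky g Gg]; first by rewrite /dot trmx0 mul0mx mxE.
  by rewrite dotDl -(addr0 0) lerD ?Ky ?Kz.
by rewrite dotZl mulr_ge0_le0 // Ky.
Qed.

(** For [y] in a convex cone [K], the set of directions along which one can move
    both ways from a multiple of [y] without leaving [K].  It is the linear
    span of the minimal face of [y], see [lin_span_min_face]. *)
Definition face_span K y : set 'cV[R]_k :=
  [set z | exists2 l : R, 0 <= l & K (l *: y + z) /\ K (l *: y - z)].

Section FixedCone.
Variables (K : set 'cV[R]_k) (y : 'cV[R]_k).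
Hypotheses (coneK : convex_cone K) (Ky : K y).

Let K0 : K 0. Proof. by case: coneK. Qed.
Let KD u v : K u -> K v -> K (u + v). Proof. by case: coneK => _ h _; apply: h. Qed.
Let KZ a u : 0 <= a -> K u -> K (a *: u). Proof. by case: coneK => _ _; apply. Qed.

Lemma face_span0 : face_span K y 0.
Proof. by exists 0; rewrite ?scale0r ?subr0 ?addr0. Qed.

Lemma face_spanL a u v :
  face_span K y u -> face_span K y v -> face_span K y (a *: u + v).
Proof.
move=> [l l0 [Ku Ku']] [l' l'0 [Kv Kv']].
exists (`|a| * l + l'); first by rewrite addr_ge0 // mulr_ge0.
have Kau : K (`|a| *: (l *: y) + a *: u) /\ K (`|a| *: (l *: y) - a *: u).
  have [a0|/ltW a0] := lerP 0 a.
    by rewrite (ger0_norm a0) -scalerBr -scalerDr; split; apply: KZ.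
  have E : a *: u = - (`|a| *: u) by rewrite (ler0_norm a0) scaleNr opprK.
  by rewrite E opprK -scalerBr -scalerDr; split; apply: KZ.
rewrite scalerDl -scalerA opprD !(addrACA _ (l' *: y)).
by case: Kau => ? ?; split; apply: KD.
Qed.

Lemma face_spanZ a u : face_span K y u -> face_span K y (a *: u).
Proof.
by rewrite -[_ *: _]addr0 => Su; apply: face_spanL => //; apply: face_span0.
Qed.

Lemma face_span_base : face_span K y y.
Proof. by exists 1; rewrite // scale1r subrr; split => //; apply: KD. Qed.

Lemma face_span_vspace :
  exists U : {vspace 'cV[R]_k}, forall v, v \in U <-> face_span K y v.
Proof. by apply: linear_closed_vspace; [apply: face_span0|apply: face_spanL]. Qed.

Lemma is_face_face_span : is_face K (K `&` face_span K y).
Proof.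
split=> [|z []//||u v l Ku Kv /andP[l0 l1] [_ [a a0 [_]]]].
- by exists y; split=> //; apply: face_span_base.
- apply/convex_setP => u v l /andP[l0 l1] [Ku Su] [Kv Sv].
  have l1' : 0 <= 1 - l by rewrite subr_ge0 ltW.
  split; first by apply: KD; apply: KZ => //; apply: ltW.
  by apply: face_spanL => //; apply: face_spanZ.
- have key b x x' : 0 < b -> K x -> K x' -> K (a *: y - (b *: x + x')) ->
      (K `&` face_span K y) x.
    move=> b0 Kx Kx' h; split=> //; exists (b^-1 * a).
      by rewrite mulr_ge0 // invr_ge0 ltW.
    split.
      by apply: KD => //; apply: KZ => //; rewrite mulr_ge0 // invr_ge0 ltW.
    rewrite -scalerA -[X in _ - X](scalerK (negbT (gt_eqF b0))) -scalerBr.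
    apply: KZ; first by rewrite invr_ge0 ltW.
    by move: (KD h Kx'); rewrite opprD addrA subrK.
  have l1' : 0 < 1 - l by rewrite subr_gt0.
  move=> h; split.
    by apply: (key l u _ _ _ _ h) => //; apply: KZ => //; apply: ltW.
  rewrite (addrC (l *: u)) in h.
  by apply: (key (1 - l) v _ _ _ _ h) => //; apply: KZ => //; apply: ltW.
Qed.

(** The minimal face consists of the points of the cone that can be subtracted
    from a multiple of [y] without leaving the cone. *)
Lemma min_faceE : min_face K y = K `&` face_span K y.
Proof.
apply/seteqP; split.
  apply: smallest_sub; first exact: is_face_face_span.
  by move=> _ ->; split=> //; apply: face_span_base.
move=> z [Kz [a a0 [_ Kaz]]] F [[_ _ _ Fext] Fy].
(* [y] is the convex combination [l z + (1 - l) w]; the coefficient [l] is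
   chosen with [l a <= 1], so that [w] is in [K]. *)
pose l := (a + 2)^-1; have l0 : 0 < l by rewrite invr_gt0 ltr_wpDl.
have l1 : 0 < 1 - l by rewrite subr_gt0 invf_lt1; lra.
have la : l * a <= 1 by rewrite mulrC ler_pdivrMr ?ltr_wpDl // mul1r lerDl.
pose w := (1 - l)^-1 *: (y - l *: z).
have Kw : K w.
  apply: KZ; first by rewrite invr_ge0 ltW.
  have -> : y - l *: z = l *: (a *: y - z) + (1 - l * a) *: y.
    by apply/colP => i; rewrite !mxE; ring.
  by apply: KD; apply: KZ => //; rewrite ?subr_ge0 // ltW.
have [] // := Fext z w l Kz Kw; first by rewrite l0 -subr_gt0.
by rewrite /w scalerA mulfV ?gt_eqF // scale1r subrKC; apply: Fy.
Qed.

Lemma is_face_min_face : is_face K (min_face K y).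
Proof. by rewrite min_faceE; apply: is_face_face_span. Qed.

Lemma lin_span_min_face : lin_span (min_face K y) = face_span K y.
Proof.
rewrite min_faceE; apply/seteqP; split=> [z [s sF zs]|z [a a0 [Kz Kz']]].
  have [U hU] := face_span_vspace; apply/hU.
  by move: zs; apply/subvP/span_subvP => x /sF[_] /hU.
(* [z] is the difference of [a y + z] and [a y], and both [y] and [a y + z] are
   in the minimal face. *)
exists [:: y; a *: y + z].
  move=> x; rewrite /= !inE => /orP[]/eqP->.
    by split=> //; apply: face_span_base.
  split=> //; exists (a + a); rewrite ?addr_ge0 // scalerDl; split.
    by apply: KD => //; apply: KD; apply: KZ.
  by rewrite opprD addrACA subrr add0r.
have zE : (a *: y + z) - a *: y = z by rewrite addrAC subrr add0r.
rewrite -[X in X \in _]zE.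
apply: rpredB; first by apply: memv_span; rewrite in_cons mem_head orbT.
by apply/rpredZ/memv_span/mem_head.
Qed.

(** Every quadratic curve through [y] with coefficients in the span of the
    minimal face stays in the cone near [y]: this says that [y] is a relative
    interior point of its minimal face. *)
Lemma face_span_curve u w : face_span K y u -> face_span K y w ->
  exists2 e : R, 0 < e & forall a, `|a| <= e -> K (y + a *: u + a ^+ 2 *: w).
Proof.
move=> [l l0 [Ku Ku']] [l' l'0 [Kw _]].
have s0 : 0 < 1 + l + l' by lra.
exists (1 + l + l')^-1; first by rewrite invr_gt0.
move=> a ae; have a0 := normr_ge0 a.
have h1 : `|a| * (1 + l + l') <= 1 by rewrite -ler_pdivlMr // div1r.
have h2 : 0 <= 1 - `|a| * l - `|a| ^+ 2 * l' by nra.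
have -> : y + a *: u + a ^+ 2 *: w =
    (1 - `|a| * l - `|a| ^+ 2 * l') *: y + (`|a| *: (l *: y) + a *: u)
     + `|a| ^+ 2 *: (l' *: y + w).
  rewrite (real_normK (num_real a)); apply/colP => i; rewrite !mxE; ring.
apply: KD; last by apply: KZ => //; rewrite exprn_ge0.
apply: KD; first exact: KZ.
have [a1|/ltW a1] := lerP 0 a.
  by rewrite (ger0_norm a1) -scalerDr; apply: KZ.
have -> : a *: u = - (`|a| *: u) by rewrite (ler0_norm a1) scaleNr opprK.
by rewrite -scalerBr; apply: KZ.
Qed.

Lemma face_span_sub z : K z -> face_span K y z -> face_span K z `<=` face_span K y.
Proof.
move=> Kz [a a0 [_ Kaz]] u [l l0 [Ku Ku']]; exists (l * a); first exact: mulr_ge0.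
have h : K (l *: (a *: y - z)) by apply: KZ.
by split; [move: (KD h Ku)|move: (KD h Ku')];
   rewrite scalerBr scalerA addrA subrK.
Qed.

End FixedCone.

(** Follow, from a point [y] of [polar G], a quadratic curve with coefficients
    in the span of the minimal face of [y], on which every vector of [G] is a
    convex function.  If the curve leaves [polar G], the minimal face of the
    last point inside has a strictly smaller span. *)
Lemma polar_curve_exit G y u w T :
  let K := polar G in
  let curve a := y + a *: u + a ^+ 2 *: w in
  K y -> face_span K y u -> face_span K y w ->
  (forall g, G g -> 0 <= dot w g) -> 0 <= T -> ~ K (curve T) ->
  exists2 a : R, 0 < a & [/\ K (curve a), face_span K (curve a) `<=` face_span K y
    & ~ (face_span K y `<=` face_span K (curve a))].
Proof.
move=> K curve Ky Su Sw w0 T0 KT.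
have cK : convex_cone K := convex_cone_polar G.
have curveE g a : dot (curve a) g = dot y g + a * dot u g + a ^+ 2 * dot w g.
  by rewrite !dotDl !dotZl.
(* The exit point is the supremum [s] of [S], which [T] bounds by convexity. *)
pose S := [set a | 0 <= a /\ K (curve a)].
have S0 : S 0 by split=> //; rewrite /curve expr0n !scale0r !addr0.
have ST : ubound S T.
  move=> a [a0 Ka]; rewrite leNgt; apply/negP => Ta; apply: KT => g Gg.
  have := Ka _ Gg; have := Ky _ Gg; have := w0 _ Gg; rewrite !curveE.
  move: (dot w g) (dot y g) (dot u g) => c2 c0 c1 c20 c00 h.
  have a1 : 0 < a by apply: le_lt_trans Ta.
  rewrite -(pmulr_rle0 _ a1).
  have e1 : 0 <= c2 * a * T * (a - T) by rewrite !mulr_ge0 // subr_ge0 ltW.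
  have e2 : 0 <= T * - (c0 + a * c1 + a ^+ 2 * c2) by rewrite mulr_ge0 // oppr_ge0.
  have e3 : 0 <= (a - T) * - c0 by rewrite mulr_ge0 ?oppr_ge0 // subr_ge0 ltW.
  nra.
have supS : has_sup S by split; [exists 0; apply: S0|exists T; apply: ST].
pose s := sup S.
have sub a : S a -> a <= s by apply: ub_le_sup; exists T; apply: ST.
have s0 : 0 < s.
  have [e e0 he] := face_span_curve cK Ky Su Sw.
  apply: (lt_le_trans e0); apply: sub; split; first exact: ltW.
  by apply: he; rewrite ger0_norm // ltW.
(* A positive value of some [g] at [s] would persist within distance [d] below
   [s], where [B] bounds the slope of the quadratic. *)
have Ks : K (curve s).
  move=> g Gg; rewrite leNgt; apply/negP => pos.
  have := pos; rewrite curveE.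
  set c0 := dot y g; set c1 := dot u g; set c2 := dot w g.
  move=> {}pos; have c20 : 0 <= c2 by apply: w0.
  pose B := 1 + `|c1| + 2 * s * c2.
  have B0 : 0 < B.
    by rewrite /B; have := normr_ge0 c1; have := mulr_ge0 (ltW s0) c20; lra.
  pose d := (c0 + s * c1 + s ^+ 2 * c2) / B.
  have d0 : 0 < d by rewrite divr_gt0.
  have [t [t0 Kt] st] := sup_adherent d0 supS.
  have ts : t <= s by apply: sub.
  have := Kt _ Gg; rewrite curveE -/c0 -/c1 -/c2 => h.
  have dB : d * B = c0 + s * c1 + s ^+ 2 * c2 by rewrite divfK // gt_eqF.
  have st' : s - t < d by rewrite -/s in st; lra.
  have e1 : (s - t) * B < d * B by rewrite ltr_pM2r.
  have e2 : (s - t) * c1 <= (s - t) * `|c1|.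
    by rewrite ler_wpM2l ?subr_ge0 // ler_norm.
  have e3 : 0 <= (s - t) ^+ 2 * c2 by rewrite mulr_ge0 // sqr_ge0.
  have e4 : (s - t) * B = (s - t) + (s - t) * `|c1| + (s - t) * (2 * s * c2).
    by rewrite /B; ring.
  have e5 : t ^+ 2 * c2 =
      s ^+ 2 * c2 - (s - t) * (2 * s * c2) + (s - t) ^+ 2 * c2 by ring.
  have e6 : t * c1 = s * c1 - (s - t) * c1 by ring.
  rewrite dB in e1; lra.
exists s => //; split=> //.
  apply: face_span_sub => //; rewrite /curve.
  by rewrite addrC; apply: face_spanL => //; rewrite addrC;
     apply: face_spanL => //; apply: face_span_base.
(* Otherwise the curve, recentered at [s], would continue inside the cone. *)
move=> sS.
have Sv : face_span K (curve s) (u + (2 * s) *: w).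
  by rewrite addrC; apply: face_spanL => //; apply: sS.
have [e e0 he] := face_span_curve cK Ks Sv (sS _ Sw).
have : S (s + e).
  split; first by rewrite addr_ge0 // ltW.
  have := he e; rewrite ger0_norm ?(ltW e0) // => /(_ (lexx _)).
  congr K; rewrite /curve; apply/colP => i; rewrite !mxE; ring.
by move=> /sub; rewrite gerDl leNgt e0.
Qed.

End Faces.

(** * Minimization over the positive semidefinite cone *)

Lemma continuous_sum (R : realType) (T : topologicalType) (I : finType)
    (F : I -> T -> R) :
  (forall i, continuous (F i)) -> continuous (fun x => \sum_i F i x).
Proof.
move=> Fc; apply: (@continuous_big R I +%R 0 xpredT) => //.
exact: (@add_continuous R^o).
Qed.

Section PsdMinimum.
Variables (R : realType) (n : nat).
Implicit Types (Z W M : 'M[R]_n) (v : 'rV[R]_(n * n)).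

Lemma vec_mxE v i j : vec_mx v i j = v 0 (mxvec_index i j).
Proof. by rewrite -mxvecE vec_mxK. Qed.

Lemma continuous_vec_mx (C : 'M[R]_n) :
  continuous (fun v => \sum_i \sum_j C i j * vec_mx v i j : R).
Proof.
apply: (@continuous_sum _ _ _ (fun i v => \sum_j C i j * vec_mx v i j)) => i.
apply: (@continuous_sum _ _ _ (fun j v => C i j * vec_mx v i j)) => j.
move=> v; apply: (@continuousM _ _ (fun=> C i j) (fun v => vec_mx v i j)).
  exact: cst_continuous.
have -> : (fun v => vec_mx v i j) =
    (fun v : 'rV[R]_(n * n) => v 0 (mxvec_index i j)).
  by apply/funext => w; rewrite vec_mxE.
exact: coord_continuous.
Qed.

Lemma continuous_trace_vec_mx M : continuous (fun v => \tr (M *m vec_mx v) : R).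
Proof.
rewrite (_ : (fun _ => _) = fun v => \sum_i \sum_j M^T i j * vec_mx v i j).
  exact: continuous_vec_mx.
apply/funext => v; rewrite /mxtrace exchange_big /=; apply: eq_bigr => i _.
by rewrite mxE; apply: eq_bigr => j _; rewrite [M^T _ _]mxE.
Qed.

Lemma continuous_form_vec_mx (u : 'cV[R]_n) :
  continuous (fun v => form (vec_mx v) u u : R).
Proof.
rewrite (_ : (fun _ => _) = fun v => \sum_i \sum_j (u *m u^T) i j * vec_mx v i j).
  exact: continuous_vec_mx.
apply/funext => v; rewrite formE; apply: eq_bigr => i _; apply: eq_bigr => j _.
by rewrite !mxE big_ord1 !mxE mulrAC.
Qed.

Lemma closed_psd_vec_mx : closed [set v | psd (vec_mx v : 'M[R]_n)].
Proof.
have -> : [set v | psd (vec_mx v : 'M[R]_n)] =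
    \bigcap_(u in [set: 'cV[R]_n])
       ((fun v => form (vec_mx v) u u) @^-1` [set x | 0 <= x])
    `&` \bigcap_(ij in [set: 'I_n * 'I_n])
       ((fun v => v 0 (mxvec_index ij.1 ij.2) - v 0 (mxvec_index ij.2 ij.1))
          @^-1` [set x | x <= 0]).
  apply/seteqP; split=> v /=.
    move=> [/symmetricmxP vT v0]; split=> [u _|[i j] _ /=]; first exact: v0.
    have := congr1 (fun M : 'M[R]_n => M i j) vT; rewrite mxE -!vec_mxE => ->.
    by rewrite subrr.
  move=> [v0 vT]; split=> [|u]; last exact: v0.
  apply/symmetricmxP/matrixP => i j; rewrite mxE; apply/eqP; rewrite eq_le !vec_mxE.
  by have := vT (i, j) I; have := vT (j, i) I; rewrite /= !subr_le0 => -> ->.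
apply: closedI.
  apply: closed_bigI => u _; apply: preimage_closed; last exact: closed_ge.
  by move=> v _; apply: continuous_form_vec_mx.
apply: closed_bigI => -[i j] _; apply: preimage_closed; last exact: closed_le.
move=> v _; apply: (@continuousB _ _ _
  (fun w : 'rV[R]_(n * n) => w 0 (mxvec_index i j))
  (fun w => w 0 (mxvec_index j i))); exact: coord_continuous.
Qed.

Lemma psd_entry_le_trace Z i j : psd Z -> `|Z i j| <= \tr Z.
Proof.
move=> [Zs Z0]; pose e (i : 'I_n) : 'cV[R]_n := delta_mx i 0.
have d0 l : 0 <= Z l l by rewrite -form_delta; apply: Z0.
have trE : Z i i <= \tr Z /\ (i != j -> Z i i + Z j j <= \tr Z).
  rewrite /mxtrace (bigD1 i) //=; split; first by rewrite lerDl sumr_ge0.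
  by move=> ij; rewrite (bigD1 j) 1?eq_sym //= lerD2l lerDl sumr_ge0.
have [ij|ij] := eqVneq i j; first by rewrite -ij ger0_norm //; case: trE.
have {trE} := trE.2 ij.
have p1 : 0 <= form Z (e i + 1 *: e j) (e i + 1 *: e j) by apply: Z0.
have p2 : 0 <= form Z (e i + (-1) *: e j) (e i + (-1) *: e j) by apply: Z0.
move: p1 p2; rewrite !form_expand // !form_delta ler_norml; lra.
Qed.

(** A continuous function on the positive semidefinite cone attains its minimum
    as soon as the trace is bounded on its sublevel set at the origin: a trace
    bound makes the sublevel set compact. *)
Lemma psd_min_attained (F : 'M[R]_n -> R) (B : R) :
  continuous (fun v => F (vec_mx v)) ->
  (forall Z, psd Z -> F Z <= F 0 -> \tr Z <= B) ->
  exists2 Z, psd Z & forall W, psd W -> F Z <= F W.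
Proof.
move=> Fc FB.
pose D : set 'rV[R]_(n * n) :=
  [set v | psd (vec_mx v : 'M[R]_n)]
    `&` ((fun v => F (vec_mx v)) @^-1` [set x | x <= F 0]).
have Dcl : closed D.
  apply: closedI; first exact: closed_psd_vec_mx.
  by apply: preimage_closed => [v _|]; [apply: Fc|apply: closed_le].
have Dco : compact D.
  have Bco : compact
      [set v : 'rV[R]_(n * n) | forall l, `[- B, B]%classic (v ord0 l)].
    apply: (@rV_compact _ _ (fun=> `[- B, B]%classic)) => l.
    exact: segment_compact.
  apply: subclosed_compact Dcl Bco _.
  move=> v [pv Fv] l /=; rewrite in_itv /= -ler_norml.
  have [i j] := mxvec_indexP l; rewrite -vec_mxE.
  by apply: le_trans (psd_entry_le_trace _ _ pv) (FB _ pv Fv).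
have D0 : D 0 by split; rewrite /= linear0 //; apply: psd0.
have [] := EVT_min_rV (ex_intro _ _ D0) Dco (continuous_subspaceT Fc).
move=> v; rewrite in_setE => -[pv Fv] vmin; exists (vec_mx v) => // W pW.
have [FW|/ltW FW] := lerP (F W) (F 0); last exact: le_trans FW.
rewrite -(mxvecK W); apply: vmin; rewrite in_setE; split; by rewrite /= mxvecK.
Qed.

End PsdMinimum.

(** * Conic duality *)

(** First-order upper bound on the square of the positive part, whose
    derivative is twice the positive part and is 2-Lipschitz. *)
Lemma sqr_pospart_le (R : realType) (s d : R) :
  Num.max 0 (s + d) ^+ 2 <= Num.max 0 s ^+ 2 + 2 * Num.max 0 s * d + d ^+ 2.
Proof.
have [h1|h1] := lerP 0 (s + d); have [h2|h2] := lerP 0 s; nra.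
Qed.

Section ConicDuality.
Variables (R : realType) (n m : nat) (A : 'I_m.+1 -> 'M[R]_n).
Hypothesis Asym : forall i, A i \is symmetricmx.
Implicit Types (g y : 'cV[R]_m.+1) (Z : 'M[R]_n).

Lemma trace_aggregate g Z :
  \tr (aggregate A g *m Z) = \sum_i g i 0 * \tr (A i *m Z).
Proof.
rewrite /aggregate mulmx_suml raddf_sum; apply: eq_bigr => i _.
by rewrite -scalemxAl /= mxtraceZ.
Qed.

Lemma symmetricmx_aggregate g : aggregate A g \is symmetricmx.
Proof.
apply/symmetricmxP; rewrite /aggregate raddf_sum; apply: eq_bigr => i _ /=.
by rewrite linearZ /=; have /symmetricmxP -> := Asym i.
Qed.

Lemma form_aggregate g u v :
  form (aggregate A g) u v = \sum_i g i 0 * form (A i) u v.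
Proof.
rewrite /form /aggregate mulmx_sumr mulmx_suml summxE.
by apply: eq_bigr => i _; rewrite -scalemxAr -scalemxAl mxE.
Qed.

Lemma polar_Gamma_of_psd y Z :
  psd Z -> (forall i, \tr (A i *m Z) + y i 0 <= 0) -> polar (Gamma A) y.
Proof.
move=> Zp hy g [g0 gp]; have := psd_trace_ge0 gp Zp.
rewrite trace_aggregate dotE => h.
suff : \sum_i g i 0 * \tr (A i *m Z) + \sum_i y i 0 * g i 0 <= 0 by lra.
rewrite -big_split /= sumr_le0 // => i _.
by rewrite [y i 0 * _]mulrC -mulrDr mulr_ge0_le0.
Qed.

(** Conic duality under a strict feasibility assumption.  Minimize over
    positive semidefinite [Z] the squared norm of the violation
    [r_i = max (0, <A_i, Z> + y_i)].  The optimality conditions say that the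
    optimal [r] belongs to [Gamma] and [<A(r), Z> <= 0], whence
    [<y, r> >= |r|^2]; so [r] is zero when [y] is in the polar cone. *)
Lemma psd_of_polar_Gamma y :
  (exists2 g, Gamma A g & posdef (aggregate A g)) ->
  polar (Gamma A) y -> exists2 Z, psd Z & forall i, \tr (A i *m Z) + y i 0 <= 0.
Proof.
move=> [g [g0 _] gpos] yp.
pose r Z i := Num.max 0 (\tr (A i *m Z) + y i 0).
pose F Z := \sum_i r Z i ^+ 2.
have r0 Z i : 0 <= r Z i by rewrite /r le_max lexx.
have Fc : continuous (fun v => F (vec_mx v)).
  apply: (@continuous_sum _ _ _ (fun i v => r (vec_mx v) i ^+ 2)) => i.
  have rc : continuous (fun v => r (vec_mx v) i).
    move=> v; apply: (@continuous_max _ _ (fun=> 0)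
      (fun v => \tr (A i *m vec_mx v) + y i 0)).
      exact: cst_continuous.
    apply: (@continuousD _ _ _ (fun v => \tr (A i *m vec_mx v)) (fun=> y i 0)).
      exact: continuous_trace_vec_mx.
    exact: cst_continuous.
  move=> v; apply: (@continuousM _ _
    (fun v => r (vec_mx v) i) (fun v => r (vec_mx v) i)); exact: rc.
have [mu mu0 Pmu] := posdef_lower_bound gpos.
(* [Z] in the sublevel set has [<A_i, Z> + y_i <= 1 + F 0]; weight by [g] and
   use [mu I <= A(g)]. *)
pose B := (\sum_i g i 0 * (1 + F 0 - y i 0)) / mu.
have [Z Zp Zmin] : exists2 Z, psd Z & forall W, psd W -> F Z <= F W.
  apply: (@psd_min_attained _ _ _ B) => // Z Zp FZ.
  have hi i : \tr (A i *m Z) <= 1 + F 0 - y i 0.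
    have : r Z i ^+ 2 <= F 0.
      apply: le_trans FZ; rewrite /F (bigD1 i) //= lerDl sumr_ge0 // => j _.
      exact: sqr_ge0.
    have : \tr (A i *m Z) + y i 0 <= r Z i by rewrite /r le_max lexx orbT.
    nra.
  rewrite ler_pdivlMr //.
  apply: (@le_trans _ _ (\tr (aggregate A g *m Z))); last first.
    by rewrite trace_aggregate; apply: ler_sum => i _; rewrite ler_wpM2l.
  have := psd_trace_ge0 Pmu Zp.
  rewrite mulmxBl linearB /= -scalemxAl mul1mx mxtraceZ; lra.
(* First-order optimality of [Z] in the feasible direction [W]. *)
have grad W : (forall e, 0 < e -> e <= 1 -> psd (Z + e *: W)) ->
    0 <= \sum_i r Z i * \tr (A i *m W).
  move=> hW; set S := \sum_i _; pose T := \sum_i \tr (A i *m W) ^+ 2.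
  have T0 : 0 <= T by apply: sumr_ge0 => i _; apply: sqr_ge0.
  have step e : 0 < e -> e <= 1 -> 0 <= 2 * e * S + e ^+ 2 * T.
    move=> e0 e1; have := Zmin _ (hW e e0 e1).
    rewrite -subr_ge0 => /le_trans; apply.
    rewrite /F /S /T !mulr_sumr -sumrB -big_split /=; apply: ler_sum => i _.
    rewrite /r mulmxDr mxtraceD -scalemxAr mxtraceZ addrAC.
    have := sqr_pospart_le (\tr (A i *m Z) + y i 0) (e * \tr (A i *m W)).
    by rewrite exprMn; lra.
  rewrite leNgt; apply/negP => S0.
  have d0 : 0 < 1 + T - S by lra.
  (* a step at which the linear term [2 e S] outweighs [e^2 T], and [e <= 1] *)
  pose e := - S / (1 + T - S).
  have eS : e * (1 + T - S) = - S by rewrite /e; field; rewrite gt_eqF.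
  have e0 : 0 < e by rewrite divr_gt0 ?oppr_gt0.
  have e1 : e <= 1 by rewrite ler_pdivrMr // mul1r; lra.
  have := step e e0 e1; nra.
pose q : 'cV[R]_m.+1 := \col_i r Z i.
have qG : Gamma A q.
  split=> [i|]; first by rewrite mxE.
  split; first exact: symmetricmx_aggregate.
  move=> v; rewrite -/(form _ _ _) -form_trace trace_aggregate.
  under eq_bigr do rewrite mxE.
  by apply: grad => e e0 _; apply: psdD => //; apply: psdZ (ltW e0) (psd_outer v).
(* Complementary slackness: [- Z] is a feasible direction as well. *)
have compl : \sum_i r Z i * \tr (A i *m Z) <= 0.
  have : 0 <= \sum_i r Z i * \tr (A i *m - Z).
    apply: grad => e e0 e1.
    have -> : Z + e *: - Z = (1 - e) *: Z by rewrite scalerN scalerBl scale1r.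
    by apply: psdZ => //; rewrite subr_ge0.
  under eq_bigr do rewrite mulmxN raddfN mulrN.
  by rewrite sumrN oppr_ge0.
have := yp q qG; rewrite dotE; under eq_bigr do rewrite mxE.
move=> hq; exists Z => // i.
have : F Z <= 0.
  suff -> : F Z = \sum_i r Z i * \tr (A i *m Z) + \sum_i y i 0 * r Z i by lra.
  rewrite -big_split; apply: eq_bigr => j _ /=.
  rewrite /r; have [h|h] := lerP 0 (\tr (A j *m Z) + y j 0); ring.
rewrite /F (bigD1 i) //= => h.
have : 0 <= \sum_(j < m.+1 | j != i) r Z j ^+ 2.
  by apply: sumr_ge0 => j _; apply: sqr_ge0.
have : \tr (A i *m Z) + y i 0 <= r Z i by rewrite /r le_max lexx orbT.
have := r0 Z i; nra.
Qed.

End ConicDuality.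

(** * Rounding *)

Section Rounding.
Variables (R : realType) (n m : nat).
Variables (A : 'I_m.+1 -> 'M[R]_n) (b : 'I_m.+1 -> 'cV[R]_n).
Variable c : 'I_m.+1 -> R.
Hypothesis Asym : forall i, A i \is symmetricmx.
Hypothesis Gamma_posdef : exists2 g, Gamma A g & posdef (aggregate A g).
Implicit Types (p d : 'cV[R]_n * R^o) (g : 'cV[R]_m.+1) (a : R).

Local Notation K := (polar (Gamma A)).
Local Notation S := (epigraph A b c).
Local Notation SDP := (sdp_relaxation A b c).
Local Notation qt := (shifted_quad A b c).
Local Notation convS := (conv_hull S).

(** The coefficient of order one of [shifted_quad] along the line [p + a d]. *)
Definition slope p d : 'cV[R]_m.+1 :=
  (\col_i (2 * form (A i) p.1 d.1 + 2 * dot (b i) d.1))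
    - (2 * (d.2 : R)) *: delta_mx ord0 0.

(** The coefficient of order two, which does not depend on [p]. *)
Definition curvature d : 'cV[R]_m.+1 := \col_i form (A i) d.1 d.1.

Lemma shifted_quad_line p d a :
  qt (p + a *: d) = qt p + a *: slope p d + a ^+ 2 *: curvature d.
Proof.
apply/colP => i; rewrite !mxE /quad /= -!/(form _ _ _) form_expand // dotDr dotZr.
have -> : a *: d.2 = a * d.2 by [].
ring.
Qed.

Lemma dot_curvature d g : dot (curvature d) g = form (aggregate A g) d.1 d.1.
Proof.
rewrite dotC form_aggregate dotE; apply: eq_bigr => i _; by rewrite mxE.
Qed.

Lemma dot_curvature_ge0 d g : Gamma A g -> 0 <= dot (curvature d) g.
Proof. by move=> [_ [_ gp]]; rewrite dot_curvature; apply: gp. Qed.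

Lemma dot_line p d a g : dot (qt (p + a *: d)) g =
  dot (qt p) g + a * dot (slope p d) g + a ^+ 2 * dot (curvature d) g.
Proof. by rewrite shifted_quad_line 2!dotDl 2!dotZl. Qed.

Lemma shifted_quad0E p : qt p ord0 0 = quad A b c ord0 p.1 - 2 * p.2.
Proof. by rewrite !mxE !eqxx mulr1. Qed.

Lemma shifted_quadSE p i : qt p (lift ord0 i) 0 = quad A b c (lift ord0 i) p.1.
Proof. by rewrite /shifted_quad !mxE mulr0 subr0. Qed.

Lemma lifted_quadE X p i :
  lifted_quad A b c i X p.1 = \tr (A i *m (X - p.1 *m p.1^T)) + quad A b c i p.1.
Proof.
by rewrite /lifted_quad /quad -/(form _ _ _) mulmxBr linearB /= form_trace; ring.
Qed.

Lemma sdp_relaxation_polar p : SDP p <-> K (qt p).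
Proof.
split=> [[X [Xs Xp h0 hi]]|/(psd_of_polar_Gamma Asym Gamma_posdef)[Z Zp hZ]].
  apply: polar_Gamma_of_psd Xp _ => i.
  have [j ->|->] := unliftP ord0 i.
    by rewrite shifted_quadSE -lifted_quadE.
  by rewrite shifted_quad0E addrA -lifted_quadE subr_le0.
exists (Z + p.1 *m p.1^T); rewrite addrK; split=> //.
- by apply: symmetricmxD; [case: Zp|apply: symmetricmx_outer].
- by have := hZ ord0; rewrite shifted_quad0E lifted_quadE addrK; lra.
- by move=> j; have := hZ (lift ord0 j); rewrite shifted_quadSE lifted_quadE addrK.
Qed.

Lemma sub_epigraph_sdp_relaxation : S `<=` SDP.
Proof.
move=> p [h0 hi]; apply/sdp_relaxation_polar.
apply: (polar_Gamma_of_psd (psd0 R n)) => i; rewrite mulmx0 mxtrace0 add0r.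
have [j ->|->] := unliftP ord0 i; first by rewrite shifted_quadSE.
by rewrite shifted_quad0E subr_le0.
Qed.

Lemma convex_sdp_relaxation : @convex_set R ('cV[R]_n * R^o)%type SDP.
Proof.
apply/convex_setP => p q l /andP[l0 l1].
move=> /sdp_relaxation_polar Kp /sdp_relaxation_polar Kq.
apply/sdp_relaxation_polar => g Gg.
have -> : l *: p + (1 - l) *: q = q + l *: (p - q).
  by rewrite scalerBr scalerBl scale1r addrCA addrA.
have hp := dot_line q (p - q) 1 g; rewrite scale1r subrKC in hp.
have := Kp g Gg; have := Kq g Gg; have := dot_curvature_ge0 (p - q) Gg.
rewrite hp (dot_line q (p - q) l g).
move: (dot (qt q) g) (dot (slope q _) g) (dot (curvature _) g) => x y z.
rewrite expr1n !mul1r => z0 x0 xyz0; have l1' : 0 <= 1 - l by rewrite subr_ge0 ltW.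
have e1 : 0 <= l * (1 - l) * z by rewrite !mulr_ge0 // ltW.
have e2 : 0 <= (1 - l) * - x by rewrite mulr_ge0 // oppr_ge0.
have e3 : 0 <= l * - (x + y + z) by rewrite mulr_ge0 ?oppr_ge0 // ltW.
nra.
Qed.

Lemma epigraph_up p (s : R^o) : 0 <= s -> S p -> S (p + (0, s)).
Proof.
move=> s0 [h0 hi]; split=> /=; rewrite addr0 //.
by rewrite mulrDr (le_trans h0) // lerDl mulr_ge0.
Qed.

(** Strict feasibility persists under a small increase of the objective
    coordinate. *)
Lemma Gamma_posdef_objective :
  exists2 g, Gamma A g & posdef (aggregate A g) /\ 0 < g ord0 0.
Proof.
have [g [g0 gp] gpos] := Gamma_posdef.
have [mu mu0 hmu] := posdef_lower_bound gpos.
have [B B0 hB] := form_bounded (A ord0).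
(* [e A_0] costs at most half of the lower bound [mu] on the form of [g] *)
pose e := mu / (2 * B); have e0 : 0 < e by rewrite divr_gt0 // mulr_gt0.
pose g' := g + e *: delta_mx ord0 0.
have formg' u : form (aggregate A g') u u =
    form (aggregate A g) u u + e * form (A ord0) u u.
  rewrite !form_aggregate !big_ord_recl !mxE eqxx mulr1 mulrDl addrAC.
  congr (_ + _ + _).
  by apply: eq_bigr => i _; rewrite !mxE mulr0 addr0.
have pos' : posdef (aggregate A g').
  split=> [|u u0]; first exact: symmetricmx_aggregate.
  have := hmu.2 u; rewrite -!/(form _ _ _) formB formZ form1 formg' => h.
  have := hB u; rewrite ler_norml => /andP[h' _].
  have : e * (B * dot u u) = mu / 2 * dot u u by rewrite /e; field; rewrite gt_eqF.
  have : e * - (B * dot u u) <= e * form (A ord0) u u by rewrite ler_pM2l.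
  have := mulr_gt0 mu0 (dot_gt0 u0); lra.
exists g'; last first.
  by split=> //; rewrite !mxE eqxx mulr1 ltr_wpDl.
split=> [i|]; first by rewrite !mxE addr_ge0 // mulr_ge0 ?(ltW e0).
case: (pos') => s h; split=> // u.
have [->|u0] := eqVneq u 0; first by rewrite mulmx0 mxE.
exact/ltW/h.
Qed.

Lemma slope0E p d i : d.1 = 0 -> slope p d i 0 = - 2 * d.2 * (i == ord0)%:R.
Proof.
move=> d1; rewrite !mxE d1 andbT.
have -> : form (A i) p.1 0 = 0 by rewrite /form mulmx0 mxE.
have -> : dot (b i) 0 = 0 by rewrite /dot mulmx0 mxE.
ring.
Qed.

Lemma ray_exit p d : d.1 != 0 \/ d.1 = 0 /\ d.2 < 0 ->
  exists2 T : R, 0 <= T & ~ K (qt (p + T *: d)).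
Proof.
have [g Gg [gpos g0]] := Gamma_posdef_objective.
move=> hd; suff [T T0 hT] : exists2 T : R, 0 <= T & 0 < dot (qt (p + T *: d)) g.
  by exists T => // /(_ g Gg); rewrite leNgt hT.
set c0 := dot (qt p) g; set c1 := dot (slope p d) g; set c2 := dot (curvature d) g.
have := normr_ge0 c0; have := normr_ge0 c1.
have := ler_norm (- c0); have := ler_norm (- c1); rewrite !normrN => n1 n0 p1 p0.
case: hd => [d1|[d1 d2]].
  have c2_gt0 : 0 < c2 by rewrite /c2 dot_curvature; apply: gpos.2.
  (* [T >= 1] and [T c2 > |c0| + |c1|], so the leading term dominates *)
  pose T := 1 + (`|c0| + `|c1|) / c2.
  have q0 : 0 <= (`|c0| + `|c1|) / c2 by rewrite divr_ge0 ?addr_ge0 // ltW.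
  have Tc : T * c2 = c2 + (`|c0| + `|c1|) by rewrite /T; field; rewrite gt_eqF.
  have T1 : 1 <= T by rewrite /T; lra.
  exists T; first lra.
  rewrite (dot_line p d T g) -/c0 -/c1 -/c2 expr2 -mulrA Tc; nra.
have c20 : c2 = 0 by rewrite /c2 dot_curvature d1 /form mulmx0 mxE.
have c1_gt0 : 0 < c1.
  have -> : c1 = (- 2 * d.2) * g ord0 0.
    rewrite /c1 dotE (bigD1 ord0) //= big1 => [|i i0].
      by rewrite slope0E // eqxx mulr1 addr0.
    by rewrite slope0E // (negbTE i0) mulr0n mulr0 mul0r.
  by rewrite mulr_gt0 // mulNr oppr_gt0 pmulr_rlt0.
exists ((`|c0| + 1) / c1); first by rewrite divr_ge0 ?addr_ge0 // ltW.
rewrite (dot_line p d _ g) -/c0 -/c1 -/c2 c20 mulr0 addr0 divfK ?gt_eqF //; lra.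
Qed.

(** The quadratic map along the line [p + a d] stays in the span of the minimal
    face exactly when both of its coefficients lie in that span. *)
Lemma rounding_dirsP p d : SDP p ->
  rounding_dirs A b c p d <->
  face_span K (qt p) (slope p d) /\ face_span K (qt p) (curvature d).
Proof.
move=> /sdp_relaxation_polar Kp; have cK := convex_cone_polar (Gamma A).
have FL := @face_spanL R m.+1 K (qt p) cK; have Fy := face_span_base cK Kp.
rewrite /rounding_dirs /= lin_span_min_face //; split=> [h|[hu hw] a]; last first.
  rewrite shifted_quad_line addrC; apply: (FL) => //.
  by rewrite addrC; apply: (FL).
have := h 1; have := h (-1).
rewrite !shifted_quad_line sqrrN expr1n scale1r scaleN1r scale1r.
(* Both coefficients are combinations of the values at 0, 1 and -1. *)
set u := slope p d; set w := curvature d => hm hp.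
have F0 := @face_span0 R m.+1 K (qt p) cK.
split.
  have -> : u = 2^-1 *: (qt p + u + w) + ((- 2^-1) *: (qt p - u + w) + 0).
    by apply/colP => i; rewrite !mxE; field.
  by apply: (FL) => //; apply: (FL).
have -> : w = 2^-1 *: (qt p + u + w)
    + (2^-1 *: (qt p - u + w) + ((- 1) *: qt p + 0)).
  by apply/colP => i; rewrite !mxE; field.
by do 3 (apply: (FL) => //).
Qed.

(** From a point of the relaxation, following a nonzero rounding direction that is
    not vertically upwards leads to a point whose minimal face has a strictly smaller
    span. *)
Lemma rounding_step p d : SDP p -> rounding_dirs A b c p d ->
  d.1 != 0 \/ d.1 = 0 /\ d.2 < 0 ->
  exists2 a : R, 0 < a & [/\ SDP (p + a *: d),
    face_span K (qt (p + a *: d)) `<=` face_span K (qt p)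
    & ~ (face_span K (qt p) `<=` face_span K (qt (p + a *: d)))].
Proof.
move=> Sp /(rounding_dirsP _ Sp)[hu hw] /(ray_exit p)[T T0 hT].
have /sdp_relaxation_polar Kp := Sp.
have [|a a0 [Ka sub nsub]] := @polar_curve_exit _ _ _ _ _ _ T Kp hu hw
  (dot_curvature_ge0 d) T0.
  by rewrite -shifted_quad_line.
exists a => //; rewrite -shifted_quad_line in Ka sub nsub.
by split=> //; apply/sdp_relaxation_polar.
Qed.

Lemma rounding_dirsN p d :
  rounding_dirs A b c p d -> rounding_dirs A b c p (- d).
Proof. by move=> h a; rewrite scalerN -scaleNr; apply: h. Qed.

(** Iterated rounding: by [rounding_step], [p] is between two points of the
    relaxation with smaller minimal faces, or above one such point.  The
    induction is on a strict upper bound [N] of the dimension of the span of the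
    minimal face. *)
Lemma rounding_conv_hull :
  (forall p, (SDP `\` S) p -> rounding_dirs A b c p <> [set 0]) ->
  SDP `<=` convS.
Proof.
move=> H p; have cK := convex_cone_polar (Gamma A).
suff main N : forall p, SDP p ->
    (exists2 U : {vspace 'cV[R]_m.+1},
       (\dim U < N)%N & forall v, v \in U <-> face_span K (qt p) v) -> convS p.
  move=> Sp; have /sdp_relaxation_polar Kp := Sp.
  have [U hU] := face_span_vspace (qt p) cK.
  by apply: (main (\dim U).+1) => //; exists U.
elim: N => {p} [|N IH] p Sp [U //]; rewrite ltnS => dimU hU.
have [/sub_conv_hull //|nS] := pselect (S p).
have smaller d : rounding_dirs A b c p d -> d.1 != 0 \/ d.1 = 0 /\ d.2 < 0 ->
    exists2 a : R, 0 < a & convS (p + a *: d).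
  move=> rd hd; have [a a0 [Sa sub nsub]] := rounding_step Sp rd hd.
  exists a => //; apply: IH => //.
  have [V hV] := face_span_vspace (qt (p + a *: d)) cK.
  exists V => //; apply: leq_trans dimU; rewrite ltnNge; apply/negP => dUV.
  have VU : (V <= U)%VS by apply/subvP => v /hV /sub /hU.
  have /eqP VE : V == U by rewrite eqEdim VU dUV.
  by apply: nsub => v /hU; rewrite -VE => /hV.
have [d rd d0] : exists2 d, rounding_dirs A b c p d & d != 0.
  apply: contrapT => h; apply: (H p) => //; apply/seteqP; split=> d /=.
    by move=> rd; apply: contrapT => /eqP d0; apply: h; exists d.
  move=> ->; have /sdp_relaxation_polar Kp := Sp.
  by move=> a; rewrite scaler0 addr0 lin_span_min_face //; apply: face_span_base.
have rNd := rounding_dirsN rd.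
(* For a vertical direction, only the downward ray leaves the relaxation. *)
have [d1|d1] := eqVneq d.1 0.
  have [e re [e1 e2]] : exists2 e, rounding_dirs A b c p e & e.1 = 0 /\ e.2 < 0.
    have : (d.2 : R) != 0.
      by apply: contraNneq d0 => d2; apply/eqP; case: (d) d1 d2 => ? ? /= -> ->.
    rewrite neq_lt => /orP[d2|d2]; first by exists d.
    by exists (- d) => //=; rewrite d1 oppr0 oppr_lt0.
  have [a a0 hull] := smaller e re (or_intror (conj e1 e2)).
  have -> : p = (p + a *: e) + (0, - (a * e.2)).
    case: (p) (e) e1 => [x t] [x' t'] /= ->; congr (_, _) => /=.
      by rewrite scaler0 !addr0.
    by rewrite /= addrK.
  apply: conv_hull_translate hull => q; apply: epigraph_up.
  by rewrite oppr_ge0 pmulr_rle0 // ltW.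
have [a a0 ha] := smaller d rd (or_introl d1).
have [|a' a'0 ha'] := smaller (- d) rNd; first by left; rewrite /= oppr_eq0.
have s0 : 0 < a + a' by rewrite addr_gt0.
have -> : p = (a' / (a + a')) *: (p + a *: d)
    + (1 - a' / (a + a')) *: (p + a' *: - d).
  rewrite !scalerDr addrACA -scalerDl subrKC scale1r.
  rewrite scalerN scalerN !scalerA -scalerBl.
  rewrite (_ : _ - _ = 0) ?scale0r ?addr0 //; field; exact: lt0r_neq0.
move/convex_setP: (@convex_conv_hull R _ S); apply=> //.
by rewrite divr_gt0 //= ltr_pdivrMr // mul1r ltrDr.
Qed.

(** Conversely, if the hull is the whole relaxation, a point [p] of it outside
    the epigraph lies inside a nontrivial segment of the relaxation.  The vector
    [g] exposing the minimal face of [p] defines a convex quadratic function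
    that is nonpositive on that segment and zero at [p], hence zero on the
    line: the end points belong to the minimal face of [p], so the direction of
    the segment is a rounding direction. *)
Lemma conv_hull_rounding :
  polar_facially_exposed (Gamma A) -> convS = SDP ->
  forall p, (SDP `\` S) p -> rounding_dirs A b c p <> [set 0].
Proof.
move=> exposed hull p [Sp nS].
have cK := convex_cone_polar (Gamma A).
have /sdp_relaxation_polar Kp := Sp.
have hp : convS p by rewrite hull.
have [y [z [l [hy hz yp /andP[l0 l1] pE]]]] := conv_hull_not_extreme hp nS.
rewrite hull in hy hz.
move: hy hz => /sdp_relaxation_polar Ky /sdp_relaxation_polar Kz.
(* [p] is at parameter 0 of the segment from [z], at [- t], to [y], at 1. *)
pose d := y - p; pose t := l / (1 - l).
have l1' : 0 < 1 - l by rewrite subr_gt0.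
have t0 : 0 < t by rewrite divr_gt0.
have yE : y = p + 1 *: d by rewrite scale1r subrKC.
have zE : z = p + (- t) *: d.
  apply: (scalerI (lt0r_neq0 l1')).
  have -> : (1 - l) *: z = p - l *: y by rewrite {1}pE addrAC subrr add0r.
  rewrite scalerDr scalerA mulrN mulrCA mulfV ?lt0r_neq0 // mulr1 scaleNr.
  by rewrite scalerBr scalerBl scale1r opprB addrA subrK.
have [g Gg FE] := exposed _ (is_face_min_face cK Kp).
have memF v : min_face K (qt p) v <-> K v /\ dot v g = 0 by rewrite FE.
have sub v : min_face K (qt p) v -> face_span K (qt p) v.
  by rewrite min_faceE // => -[].
have c0 : dot (qt p) g = 0.
  have /memF[] // : min_face K (qt p) (qt p).
  by rewrite min_faceE //; split=> //; apply: face_span_base.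
have c2 := dot_curvature_ge0 d Gg.
have := Ky g Gg; have := Kz g Gg; rewrite yE zE.
rewrite (dot_line p d 1 g) (dot_line p d (- t) g) c0 !add0r.
rewrite expr1n !mul1r sqrrN => ht h1.
have c20 : dot (curvature d) g = 0 by nra.
have c10 : dot (slope p d) g = 0 by rewrite c20 in ht h1; nra.
have Fline a : K (qt (p + a *: d)) -> face_span K (qt p) (qt (p + a *: d)).
  move=> Ka; apply/sub/memF; split=> //.
  by rewrite (dot_line p d a g) c0 c10 c20 !mulr0 !addr0.
have Fy := face_span_base cK Kp; have FL := @face_spanL R m.+1 K (qt p) cK.
have F0 := @face_span0 R m.+1 K (qt p) cK.
have := Fline 1; have := Fline (- t); rewrite -yE -zE => /(_ Kz) + /(_ Ky).
rewrite yE zE !shifted_quad_line expr1n !scale1r sqrrN.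
set u := slope p d; set w := curvature d => Fz Fy'.
(* [slope] and [curvature] are recovered from the values at 0, 1 and [- t]. *)
have tt : t * (1 + t) != 0 by rewrite mulf_neq0 // lt0r_neq0 // addr_gt0.
have Fw : face_span K (qt p) w.
  have -> : w = (t * (1 + t))^-1 *: (qt p + (- t) *: u + t ^+ 2 *: w)
      + ((1 + t)^-1 *: (qt p + u + w) + ((- t^-1) *: qt p + 0)).
    apply/colP => i; rewrite !mxE; field.
    by rewrite !lt0r_neq0 // addr_gt0.
  by do 3 (apply: (FL) => //).
have Fu : face_span K (qt p) u.
  have -> : u = 1 *: (qt p + u + w) + ((- 1) *: qt p + ((- 1) *: w + 0)).
    by apply/colP => i; rewrite !mxE; ring.
  by do 3 (apply: (FL) => //).
have rd : rounding_dirs A b c p d by apply/rounding_dirsP.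
move=> R0; move: rd; rewrite R0 /= => /eqP; rewrite subr_eq0.
by apply/negP.
Qed.

End Rounding.

Theorem theorem2 (R : realType) (n m : nat) (n_gt0 : (0 < n)%N)
    (m_gt0 : (0 < m)%N)
    (A : 'I_m.+1 -> 'M[R]_n) (b : 'I_m.+1 -> 'cV[R]_n) (c : 'I_m.+1 -> R)
    (Asym : forall i, A i \is symmetricmx)
    (Gamma_posdef : exists2 g, Gamma A g & posdef (aggregate A g))
    (Gamma_exposed : polar_facially_exposed (Gamma A)) :
  conv_hull (epigraph A b c) = sdp_relaxation A b c <->
  (forall p, (sdp_relaxation A b c `\` epigraph A b c) p ->
     rounding_dirs A b c p <> [set 0]).
Proof.
split; first exact: conv_hull_rounding.
move=> H; apply/seteqP; split; last exact: rounding_conv_hull.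
apply: conv_hull_sub; first exact: sub_epigraph_sdp_relaxation.
exact: convex_sdp_relaxation.
Qed.
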